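(* Let $A=\{v_1,\dots,v_k\}\subset\mathbb Z^n$ be a finite set of integer vectors which contains a basis of $\mathbb R^n$, and let $\mathcal S_A$ be the stratification of the torus $\mathbb R^n/\mathbb Z^n$ induced by $A$ (defined in the context). Let \[ D_A=\operatorname{lcm}\Big\{\,\big|\det(v_{i_1},\dots,v_{i_n})\big| \neq 0 \;:\; i_1,\dots,i_n\in\{1,\dots,k\}\Big\}, \] the least common multiple of the absolute values of all nonzero determinants of $n\times n$ matrices whose columns are $n$ vectors from $A$. If $m$ is a positive integer which is a multiple of $D_A$ and satisfies $m\ge (n+1)D_A$, then $L_m\cap S\neq\emptyset$ for every stratum $S\in\mathcal S_A$, where $L_m$ denotes the image of $\frac1m\mathbb Z^n$ in $\mathbb R^n/\mathbb Z^n$.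
   Context: For $i=1,\dots,k$ let $f_i\colon \mathbb R^n/\mathbb Z^n\to\mathbb R/\mathbb Z$ be $f_i(x)=v_i\cdot x$ (dot product), and $h_i=f_i^{-1}(0)$. For $I\subset\{1,\dots,k\}$ let $h_I=\{x\in\mathbb R^n/\mathbb Z^n : f_i(x)=0 \text{ for all } i\in I\}$ (so $h_\emptyset=\mathbb R^n/\mathbb Z^n$), and let $S_{I,1},\dots,S_{I,p_I}$ be the connected components of $h_I\setminus\bigcup_{j\notin I}h_j$. The stratification induced by $A$ is $\mathcal S_A=\{S_{I,j}\}\setminus\{\emptyset\}$, the collection of all nonempty such sets, over all $I$ and $j$. *)

(* Defs.v *)
From HB Require Import structures.
From mathcomp Require Import all_boot all_order all_algebra.
From mathcomp Require Import all_classical all_reals all_analysis.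

Set Implicit Arguments.
Unset Strict Implicit.
Unset Printing Implicit Defensive.

Import Order.TTheory GRing.Theory Num.Theory.
Import Quotient.Exports.
Import numFieldNormedType.Exports.
Local Open Scope classical_set_scope.
Local Open Scope quotient_scope.
Local Open Scope ring_scope.

Definition int_real (R : realType) : pred R := fun x => x \is a Num.int.

Definition int_vec (R : realType) (n : nat) : pred 'rV[R]_n :=
  fun x => x \is a mxOver Num.int.

Fact int_real_zmod_closed (R : realType) : zmod_closed (@int_real R).
Proof. by split=> [|x y]; rewrite /in_mem /= /int_real ?rpred0 //; apply: rpredB. Qed.

HB.instance Definition _ (R : realType) :=
  GRing.isZmodClosed.Build R (@int_real R) (@int_real_zmod_closed R).

Fact int_vec_zmod_closed (R : realType) (n : nat) : zmod_closed (@int_vec R n).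
Proof.
split=> [|x y]; first by apply/mxOverP => i j; rewrite mxE rpred0.
move=> /mxOverP xZ /mxOverP yZ; apply/mxOverP => i j.
by rewrite !mxE rpredB ?xZ ?yZ.
Qed.

HB.instance Definition _ (R : realType) (n : nat) :=
  GRing.isZmodClosed.Build 'rV[R]_n (@int_vec R n) (@int_vec_zmod_closed R n).

(* R / Z as an abelian group (its topology is not needed). *)
Definition circle (R : realType) : zmodType :=
  Quotient.quot (GRing.ZmodClosed.clone R (@int_real R) _).

Definition to_circle (R : realType) (x : R) : circle R := \pi x.

Definition torus_quot (R : realType) (n : nat) : quotType 'rV[R]_n :=
  Quotient.quot (GRing.ZmodClosed.clone 'rV[R]_n (@int_vec R n) _).

(* R^n / Z^n with the quotient of the usual topology of R^n. *)
Definition torus (R : realType) (n : nat) : topologicalType :=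
  quotient_topology (torus_quot R n).

Definition to_torus (R : realType) (n : nat) (x : 'rV[R]_n) : torus R n :=
  \pi_(torus_quot R n) x.

Definition real_vec (R : realType) (n : nat) (v : 'rV[int]_n) : 'rV[R]_n :=
  map_mx intr v.

Definition dot (R : realType) (n : nat) (u x : 'rV[R]_n) : R :=
  \sum_(i < n) u 0 i * x 0 i.

(* Independent of the chosen representative: see torus_dotE. *)
Definition torus_dot (R : realType) (n : nat) (v : 'rV[int]_n) (x : torus R n) :
    circle R :=
  to_circle (dot (real_vec R v) (repr (x : torus_quot R n))).

Lemma torus_dotE (R : realType) (n : nat) (v : 'rV[int]_n) (x : 'rV[R]_n) :
  torus_dot v (to_torus x) = to_circle (dot (real_vec R v) x).
Proof.
apply/eqP; rewrite /to_circle -Quotient.idealrBE /dot -sumrB.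
rewrite /in_mem /= /int_real; apply: rpred_sum => i _.
rewrite -mulrBr mxE rpredM ?intr_int //.
have : repr (to_torus x : torus_quot R n) - x \in @int_vec R n.
  by rewrite Quotient.idealrBE reprK.
by move=> /mxOverP/(_ 0 i); rewrite !mxE.
Qed.

Section Stratification.
Variables (R : realType) (n k : nat) (v : 'I_k -> 'rV[int]_n).

Definition hyper (i : 'I_k) : set (torus R n) := [set x | torus_dot (v i) x = 0].

Definition flat (I : {set 'I_k}) : set (torus R n) :=
  [set x | forall i, i \in I -> torus_dot (v i) x = 0].

Definition open_flat (I : {set 'I_k}) : set (torus R n) :=
  flat I `\` \bigcup_(j in [set j | j \notin I]) hyper j.

Definition strata : set (set (torus R n)) :=
  [set S | exists I x, open_flat I x /\ S = connected_component (open_flat I) x]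
  `\ set0.

Definition contains_basis : Prop :=
  exists2 b : seq 'rV[R]_n,
    basis_of fullv b & {subset b <= codom (fun i => real_vec R (v i))}.

End Stratification.

(* The columns are the vectors v (c j), possibly with repetitions. *)
Definition minor (n k : nat) (v : 'I_k -> 'rV[int]_n) (c : {ffun 'I_n -> 'I_k}) : int :=
  \det (\matrix_(i < n, j < n) v (c j) 0 i).

Definition lcm_minors (n k : nat) (v : 'I_k -> 'rV[int]_n) : nat :=
  \big[lcmn/1%N]_(c : {ffun 'I_n -> 'I_k} | minor v c != 0) `|minor v c|%N.

(* The image in R^n / Z^n of (1/m) Z^n. *)
Definition lattice_points (R : realType) (n m : nat) : set (torus R n) :=
  [set to_torus (m%:R^-1 *: real_vec R z) | z in [set: 'rV[int]_n]].
Arguments lattice_points R n m : clear implicits.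

(* Main.v *)
(* Lift a point of the stratum to [x] in R^n and let Q be the polytope cut out by
   floor (v_i . x) <= v_i . y <= ceil (v_i . x); it is bounded because the v_i
   span. A vertex of Q solves a nonsingular system with n of the v_i as rows and
   an integral right-hand side, so by Cramer's rule D_A times a vertex is
   integral. By Caratheodory [x] is a convex combination, with positive
   coefficients, of at most n+1 vertices, so every inequality that is strict at
   [x] is strict at one of them. Writing m = q D_A with q >= n+1, take the
   average [y] of q vertices, with repetitions, that include all of these: then
   m y is integral and the same inequalities are strict at [y] as at [x]. Hence
   the segment from [x] to [y] projects into the open flat of the stratum, and
   [y] lies in the same connected component as [x]. *)
Require Import Defs.
From mathcomp Require Import all_boot all_order all_algebra.
From mathcomp Require Import all_classical all_reals all_analysis.
From mathcomp Require Import zify ring lra.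

Set Implicit Arguments.
Unset Strict Implicit.
Unset Printing Implicit Defensive.

Import Order.TTheory GRing.Theory Num.Theory.
Import numFieldNormedType.Exports.
Local Open Scope classical_set_scope.
Local Open Scope ring_scope.

(** * Segments and linearity of the dot product *)

Lemma lt_segment (R : realFieldType) (a x y t : R) :
  0 <= t <= 1 -> a < x -> a < y -> a < x + t * (y - x).
Proof.
move=> /andP[t0]; rewrite le_eqVlt => /predU1P[->|t1] ax ay; first by lra.
have : 0 < (1 - t) * (x - a) by rewrite mulr_gt0 ?subr_gt0.
have : 0 <= t * (y - a) by rewrite mulr_ge0 // subr_ge0 ltW.
lra.
Qed.

Section Dot.
Variables (R : realType) (n : nat).
Implicit Types u x y : 'rV[R]_n.

Lemma dot_mulmx u x : dot u x = (x *m u^T) 0 0.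
Proof. by rewrite mxE; apply: eq_bigr => i _; rewrite mxE mulrC. Qed.

Lemma dotDr u x y : dot u (x + y) = dot u x + dot u y.
Proof. by rewrite !dot_mulmx mulmxDl mxE. Qed.

Lemma dotZr u a x : dot u (a *: x) = a * dot u x.
Proof. by rewrite !dot_mulmx -scalemxAl mxE. Qed.

Lemma dotBr u x y : dot u (x - y) = dot u x - dot u y.
Proof. by rewrite -scaleN1r dotDr dotZr mulN1r. Qed.

Lemma dotNl u x : dot (- u) x = - dot u x.
Proof. by rewrite !dot_mulmx linearN mulmxN mxE. Qed.

Lemma dot_sumr (I : Type) (s : seq I) (F : I -> 'rV[R]_n) u :
  dot u (\sum_(i <- s) F i) = \sum_(i <- s) dot u (F i).
Proof.
by rewrite dot_mulmx mulmx_suml summxE; apply: eq_bigr => i _; rewrite dot_mulmx.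
Qed.

End Dot.

(** * Vertices of a polyhedron and averages of them *)

Section Polyhedron.
Variables (R : realType) (n : nat) (J : finType).
Variables (u : J -> 'rV[R]_n) (b : J -> R).
Implicit Types x w p : 'rV[R]_n.

Definition polyhedron x := forall c, dot (u c) x <= b c.
Definition tight x c := dot (u c) x == b c.
(** Extremality is stated by linear algebra, as triviality of the directions orthogonal to all tight
    normals; this is the form in which a nonsingular subsystem can be extracted. *)
Definition vertex p :=
  polyhedron p /\ forall w, (forall c, tight p c -> dot (u c) w = 0) -> w = 0.

(** The ratio test of the simplex method: [t] is the least quotient of slack by speed over the
    constraints that increase along [w]. It is positive because a tight constraint has speed
    zero. *)
Lemma ray_exit x w :
  polyhedron x -> (forall c, tight x c -> dot (u c) w = 0) ->
  (exists c, 0 < dot (u c) w) ->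
  exists t, [/\ 0 < t, polyhedron (x + t *: w)
              & exists c, 0 < dot (u c) w /\ tight (x + t *: w) c].
Proof.
move=> xP x_w [c0 c0_gt0].
case: (arg_minP (fun c => (b c - dot (u c) x) / dot (u c) w)
         (P := fun c => 0 < dot (u c) w) c0_gt0) => c cw_gt0 c_min.
exists ((b c - dot (u c) x) / dot (u c) w); split.
- rewrite divr_gt0 // subr_gt0 lt_neqAle xP andbT.
  by apply/negP => /x_w cw0; rewrite cw0 ltxx in cw_gt0.
- move=> d; rewrite dotDr dotZr -lerBrDl.
  case: (ltP 0 (dot (u d) w)) => dw; first by rewrite -ler_pdivlMr // c_min.
  apply: (@le_trans _ _ 0); last by rewrite subr_ge0.
  by rewrite mulr_ge0_le0 // divr_ge0 ?subr_ge0 // ltW.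
- exists c; split=> //.
  by rewrite /tight dotDr dotZr divfK ?lt0r_neq0 // addrC subrK.
Qed.

(** While a nonzero direction fixes all tight constraints, following it to the exit point makes one
    more constraint tight; the number of slack ones decreases. The first hypothesis, a form of
    boundedness, ensures that every ray exits. *)
Lemma face_vertex x :
  (forall w, w != 0 -> exists c, 0 < dot (u c) w) -> polyhedron x ->
  exists p, vertex p /\ forall c, tight x c -> tight p c.
Proof.
move=> bnd; have [N] := ubnP #|[pred c | ~~ tight x c]|.
elim: N x => // N IHN x; rewrite ltnS => leN xP.
case: (pselect (exists w, w != 0 /\ forall c, tight x c -> dot (u c) w = 0)).
  case=> w [w0 x_w].
  have [t [t_gt0 yP [c [cw_gt0 yc]]]] := ray_exit xP x_w (bnd _ w0).
  have sub d : tight x d -> tight (x + t *: w) d.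
    by move=> xd; rewrite /tight dotDr dotZr x_w // mulr0 addr0.
  have [|//|p [pV yp]] := IHN (x + t *: w).
    apply: leq_trans leN; apply: proper_card; apply/properP; split.
      by apply/fintype.subsetP => d; rewrite !inE; apply: contra; apply: sub.
    exists c; rewrite !inE ?yc //.
    by apply/negP => /x_w cw0; rewrite cw0 ltxx in cw_gt0.
  by exists p; split=> // d /sub /yp.
move=> noW; exists x; split=> //; split=> // w xw.
by apply/eqP/negP => /negP w0; apply: noW; exists w.
Qed.

(* A weak form of Caratheodory's theorem: the convex coefficients are
   forgotten, only the constraints that are slack at [x] are remembered. *)
Lemma vertices_around m (W : 'M[R]_(m, n)) x :
  (forall w, w != 0 -> exists c, 0 < dot (u c) w) -> polyhedron x ->
  (forall w, (forall c, tight x c -> dot (u c) w = 0) -> (w <= W)%MS) ->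
  exists s : seq 'rV[R]_n,
    [/\ (0 < size s <= (\rank W).+1)%N, forall p, p \in s -> vertex p
      & forall c, ~~ tight x c -> has (fun p => ~~ tight p c) s].
Proof.
(* Induction on the rank of [W], a space containing all directions that keep the constraints tight
   at [x] tight. *)
move=> bnd; have [N] := ubnP (\rank W).
elim: N m W x => // N IHN m W x; rewrite ltnS => leN xP xW.
have [p [pV xp]] := face_vertex bnd xP; have [pP _] := pV.
have [<-|xNp] := eqVneq p x.
  exists [:: p]; split=> // [q|c pc]; first by rewrite inE => /eqP->.
  by rewrite /= pc.
have w0 : x - p != 0 by rewrite subr_eq0 eq_sym.
have x_w c : tight x c -> dot (u c) (x - p) = 0.
  by move=> xc; rewrite dotBr (eqP xc) (eqP (xp _ xc)) subrr.
(* The ray from the vertex [p] through [x] is prolonged to its exit point [y], so that [x] lies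
   strictly between [p] and [y]. *)
have [t [t_gt0 yP [c [cw_gt0 yc]]]] := ray_exit xP x_w (bnd _ w0).
set y := x + t *: (x - p) in yP yc.
have sub d : tight x d -> tight y d.
  by move=> xd; rewrite /tight dotDr dotZr x_w // mulr0 addr0.
(* The constraint [c] gained at [y] excludes the direction [x - p] of [W], so the rank drops. *)
pose W' := (W :&: kermx (u c)^T)%MS.
have ltW : (\rank W' < \rank W)%N.
  apply: rank_ltmx; rewrite /ltmx capmxSl /=.
  apply/negP => WW'; have := submx_trans (xW _ x_w) WW'.
  rewrite sub_capmx => /andP[_ /sub_kermxP cw].
  by rewrite dot_mulmx cw mxE ltxx in cw_gt0.
have [|//||s [/andP[s0 s_size] sV ys]] := IHN _ W' y.
- exact: leq_trans leN.
- move=> w yw; rewrite sub_capmx xW => [|d /sub/yw//].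
  apply/sub_kermxP/matrixP => i j; rewrite !ord1 -dot_mulmx mxE.
  exact: yw.
exists (p :: s); split=> [|q|d xd] /=.
- by rewrite ltnS; apply: leq_trans s_size _.
- by rewrite inE => /predU1P[->|/sV].
have [pd|//] := boolP (tight p d); apply: ys.
apply: contra xd => /eqP yd; move/eqP: pd yd => pd.
rewrite /tight dotDr dotZr dotBr pd => yd; apply/eqP.
(* A constraint tight at both [p] and [y] is tight at [x], since [1 + t] is positive. *)
have /eqP : (1 + t) * (dot (u d) x - b d) = 0 by lra.
by rewrite mulf_eq0 subr_eq0 => /orP[/eqP|/eqP//]; lra.
Qed.

(** The slack of the average is the average of the slacks, and a sum of nonnegative terms vanishes
    only if each term does. *)
Lemma average_polyhedron (s : seq 'rV[R]_n) :
  (0 < size s)%N -> (forall p, p \in s -> polyhedron p) ->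
  let y := (size s)%:R^-1 *: \sum_(p <- s) p in
  polyhedron y /\ forall c, has (fun p => ~~ tight p c) s -> ~~ tight y c.
Proof.
move=> s0 sP y; have s0' : 0 < (size s)%:R :> R by rewrite ltr0n.
have yE c : (size s)%:R * (b c - dot (u c) y) = \sum_(p <- s) (b c - dot (u c) p).
  rewrite sumrB -dot_sumr big_const_seq count_predT iter_addr_0 mulrBr.
  by rewrite /y dotZr mulrA divff ?gt_eqF // mul1r mulr_natl.
have ge0 c p : p \in s -> 0 <= b c - dot (u c) p.
  by move=> ps; rewrite subr_ge0 sP.
split=> [c|c].
  rewrite -subr_ge0 -(pmulr_rge0 _ s0') yE big_seq.
  by apply: sumr_ge0 => p /ge0.
move=> /hasP[p ps]; apply: contra => /eqP yc.
have /eqP : \sum_(q <- s) (b c - dot (u c) q) = 0.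
  by rewrite -yE yc subrr mulr0.
rewrite big_seq psumr_eq0 => [/allP/(_ p ps)|q /ge0//].
by rewrite ps /= subr_eq0 eq_sym.
Qed.

End Polyhedron.

(** * Passing between real vectors and the torus *)

Lemma to_circle_eq0 (R : realType) (a : R) : (to_circle a = 0) <-> a \is a Num.int.
Proof.
have <- : to_circle (0 : R) = 0 by rewrite /to_circle !piE.
rewrite /to_circle; split=> [/eqP|aZ].
  by rewrite -Quotient.idealrBE subr0.
by apply/eqP; rewrite -Quotient.idealrBE subr0.
Qed.

Lemma segment_in_component (R : realType) (n : nat) (O : set (torus R n))
    (x y : 'rV[R]_n) :
  (forall t, 0 <= t <= 1 -> O (to_torus (x + t *: (y - x)))) ->
  connected_component O (to_torus x) (to_torus y).
Proof.
move=> segO; pose g t : torus R n := to_torus (x + t *: (y - x)).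
have g0 : g 0 = to_torus x by rewrite /g scale0r addr0.
have g1 : g 1 = to_torus y by rewrite /g scale1r addrC subrK.
apply: (@connected_component_max _ O (g @` `[0, 1])).
- by exists 0 => //=; rewrite in_itv /= lexx ler01.
- by move=> _ [t /= t01 <-]; apply: segO; rewrite in_itv in t01.
- apply: connected_continuous_connected; first exact: segment_connected.
  apply: continuous_subspaceT => t.
  apply: (@continuous_comp _ _ _ (fun t : R => x + t *: (y - x))
    (fun z => to_torus z)); last exact: pi_continuous.
  by apply: cvgD; [exact: cvg_cst|apply: scalel_continuous].
- by exists 1 => //=; rewrite in_itv /= lexx ler01.
Qed.

(** * Integrality of vertices and lattice points in a cell *)

Section IntegerArrangement.
Variables (R : realType) (n k : nat) (v : 'I_k -> 'rV[int]_n).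
Implicit Types x y w p : 'rV[R]_n.
Let vR i := real_vec R (v i).

(** Such a [w] is orthogonal to a spanning family, hence to itself. *)
Lemma contains_basis_dot_eq0 w :
  contains_basis R v -> (forall i, dot (vR i) w = 0) -> w = 0.
Proof.
case=> b /span_basis bV b_sub vw.
have dotC x : dot x w = dot w x.
  by apply: eq_bigr => i _; rewrite mulrC.
have : dot w w = 0.
  have /coord_span {2}-> : w \in <<in_tuple b>>%VS by rewrite bV memvf.
  rewrite dot_sumr big1 // => i _; rewrite dotZr -dotC.
  have /b_sub/codomP[j ->] : (in_tuple b)`_i \in b by rewrite mem_nth.
  by rewrite [dot _ _]vw mulr0.
move=> /eqP; rewrite psumr_eq0 => [/allP w0|i _]; last by rewrite -expr2 sqr_ge0.
apply/rowP => i; rewrite mxE; apply/eqP.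
by have := w0 i (mem_index_enum i); rewrite /= mulf_eq0 orbb.
Qed.

(** Cramer's rule through the adjugate: [\det B] times [x] is [\adj B] applied to the integral
    vector [B x]. *)
Lemma det_scale_int (B : 'M[int]_n) x :
  (forall i, dot (real_vec R (row i B)) x \is a Num.int) ->
  (\det B)%:~R *: x \is a mxOver Num.int.
Proof.
move=> Bx; pose BR := map_mx intr B : 'M[R]_n.
have -> : (\det B)%:~R *: x = (map_mx intr (\adj B) *m (BR *m x^T))^T.
  rewrite mulmxA -map_mxM mul_adj_mx map_scalar_mx mul_scalar_mx.
  by rewrite linearZ /= trmxK.
apply/mxOverP => i j; rewrite !mxE rpred_sum // => l _.
rewrite rpredM ?mxE ?intr_int // (_ : \sum_j0 _ = dot (real_vec R (row l B)) x) //.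
by rewrite /dot; apply: eq_bigr => s _; rewrite !mxE !ord1.
Qed.

Lemma lcm_minors_scale_int p :
  (forall w, (forall i, dot (vR i) p \is a Num.int -> dot (vR i) w = 0) ->
    w = 0) ->
  (lcm_minors v)%:R *: p \is a mxOver Num.int.
Proof.
move=> pV.
(* Rows with a nonintegral value at [p] are zeroed; by hypothesis the remaining ones still span. *)
pose A : 'M[R]_(k, n) := \matrix_i (if dot (vR i) p \is a Num.int then vR i else 0).
have A_full : row_full A.
  rewrite /row_full -mxrank_tr -/(row_free A^T) -kermx_eq0.
  apply/rowV0P => w /sub_kermxP wA; apply: pV => i pi.
  have := congr1 (fun M : 'rV[R]_k => M 0 i) wA; rewrite !mxE => <-.
  by apply: eq_bigr => s _; rewrite !mxE pi mulrC mxE.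
pose f := fullrankfun A_full.
have A_unit : rowsub f A \in unitmx := fullrowsub_unit A_full.
have f_int s : dot (vR (f s)) p \is a Num.int.
  (* A zeroed row cannot occur in an invertible submatrix: the product with the inverse would have a
     zero on the diagonal. *)
  apply/negP => /negP/negbTE sp.
  have := congr1 (fun M : 'M[R]_n => M s s) (mulmxV A_unit); rewrite !mxE big1.
    by rewrite eqxx => /esym/eqP; rewrite oner_eq0.
  by move=> j _; rewrite !mxE sp mxE mul0r.
pose B : 'M[int]_n := \matrix_s v (f s).
have BE : rowsub f A = map_mx intr B.
  by apply/matrixP => s j; rewrite !mxE f_int mxE.
have detB0 : \det B != 0.
  by move: A_unit; rewrite BE unitmxE det_map_mx unitfE intr_eq0.
have Bp : (\det B)%:~R *: p \is a mxOver Num.int.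
  by apply: det_scale_int => s; rewrite rowK; apply: f_int.
have minorE : minor v (finfun f) = \det B.
  rewrite /minor -det_tr; congr (\det _); apply/matrixP => i j.
  by rewrite !mxE ffunE.
have /dvdnP[q ->] : (`|\det B| %| lcm_minors v)%N.
  by rewrite -minorE; apply: (biglcmn_sup (finfun f)); rewrite ?minorE.
rewrite -[X in X *: _]/((_%:Z)%:~R) PoszM abszE; apply/mxOverP => i j.
have := mxOverP Bp i j; rewrite !mxE => Bpij.
rewrite intrM -mulrA rpredM ?intr_int //.
by case: (ger0P (\det B)) => _; rewrite ?rmorphN ?mulNr ?rpredN.
Qed.

(** The flag selects the upper bound ([true]) or the negated lower bound ([false]). Taking the
    ceiling, not floor plus one, turns an integral value at [x] into an equation. *)
Definition wall (c : 'I_k * bool) := if c.2 then vR c.1 else - vR c.1.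
Definition wall_bound x (c : 'I_k * bool) : R :=
  if c.2 then (Num.ceil (dot (vR c.1) x))%:~R
  else - (Num.floor (dot (vR c.1) x))%:~R.

Lemma wall_polyhedronP x y :
  polyhedron wall (wall_bound x) y <->
  forall i, (Num.floor (dot (vR i) x))%:~R <= dot (vR i) y
            <= (Num.ceil (dot (vR i) x))%:~R.
Proof.
split=> [yP i|yP [i []]] /=; last 2 first.
- by rewrite /wall /wall_bound /=; have /andP[] := yP i.
- by rewrite /wall /wall_bound /= dotNl lerN2; have /andP[] := yP i.
have := yP (i, false); have := yP (i, true); rewrite /wall /wall_bound /=.
by rewrite dotNl lerN2 => -> ->.
Qed.

Lemma wall_tight_int x y i a :
  tight wall (wall_bound x) y (i, a) -> dot (vR i) y \is a Num.int.
Proof.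
rewrite /tight /wall /wall_bound /=; case: a; first by move=> /eqP->; rewrite intr_int.
by rewrite dotNl eqr_opp => /eqP->; rewrite intr_int.
Qed.

Lemma lattice_point_in_cell x q :
  contains_basis R v -> (n < q)%N ->
  exists y, [/\ (q * lcm_minors v)%:R *: y \is a mxOver Num.int,
    forall i, dot (vR i) x \is a Num.int -> dot (vR i) y = dot (vR i) x
    & forall i, dot (vR i) x \isn't a Num.int ->
      (Num.floor (dot (vR i) x))%:~R < dot (vR i) y
         < (Num.floor (dot (vR i) x) + 1)%:~R].
Proof.
move=> v_basis nq.
have bnd w : w != 0 -> exists c, 0 < dot (wall c) w.
  move=> w0; have [/existsP[i vw]|/existsPn vw] :=
    boolP [exists i, dot (vR i) w != 0].
    case: (ltP 0 (dot (vR i) w)) => iw; first by exists (i, true).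
    by exists (i, false); rewrite dotNl oppr_gt0 lt_neqAle vw.
  case/eqP: w0; apply: contains_basis_dot_eq0 => // i.
  by apply/eqP; have := vw i; rewrite negbK.
have xP : polyhedron wall (wall_bound x) x.
  by apply/wall_polyhedronP => i; rewrite floor_le ceil_ge.
have [|s [/andP[s0 s_size] sV xs]] := vertices_around bnd xP (W := 1%:M).
  by move=> w _; apply: submx1.
rewrite mxrank1 in s_size.
case: s s0 s_size sV xs => [//|p s] _ s_size sV xs.
(* Repeating one vertex brings the list to length exactly [q], which is possible as it has at most
   [n.+1] entries. *)
pose s' := nseq (q - size (p :: s)) p ++ p :: s.
have s'q : size s' = q.
  by rewrite size_cat size_nseq subnK // (leq_trans s_size).
have s'V r : r \in s' -> vertex wall (wall_bound x) r.
  by rewrite mem_cat mem_nseq => /orP[/andP[_ /eqP->]|/sV//]; apply/sV/mem_head.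
have [||] := average_polyhedron (u := wall) (b := wall_bound x) (s := s').
- by rewrite s'q (leq_trans _ nq).
- by move=> r /s'V[].
rewrite s'q; set y := _ *: _ => yP ys; exists y; split.
(* The factor [q] cancels the averaging, leaving a sum of vertices each scaled by [lcm_minors v]. *)
- rewrite natrM mulrC -scalerA /y [X in _ *: X]scalerA mulfV;
    last by rewrite pnatr_eq0 -lt0n (leq_trans _ nq).
  rewrite scale1r scaler_sumr; apply/mxOverP => i0 j.
  rewrite summxE big_seq rpred_sum // => r /s'V[_ rV].
  apply: mxOverP; apply: lcm_minors_scale_int => w rw.
  apply: rV => -[i a] /wall_tight_int/rw iw.
  by rewrite /wall /=; case: a; rewrite ?dotNl iw ?oppr0.
- move=> i xi; have /wall_polyhedronP/(_ i) := yP.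
  rewrite ceil_floor xi addr0 -eq_le eq_sym => /eqP->; apply/eqP.
  by rewrite -intrEfloor.
- move=> i xi; have /wall_polyhedronP/(_ i) := yP.
  have xslack a : ~~ tight wall (wall_bound x) x (i, a).
    by apply: contra xi; apply: wall_tight_int.
  have yslack a : ~~ tight wall (wall_bound x) y (i, a).
    by apply: ys; rewrite has_cat xs ?orbT.
  have := yslack true; have := yslack false; rewrite /tight /wall /wall_bound /=.
  rewrite dotNl eqr_opp ceil_floor xi /= !lt_neqAle eq_sym => -> ->.
  by [].
Qed.

End IntegerArrangement.

(** * Lattice points in the strata *)

Theorem theoremA (R : realType) (n k : nat) (v : 'I_k -> 'rV[int]_n)
    (v_basis : contains_basis R v) (m : nat) (m_gt0 : (0 < m)%N)
    (D_dvd_m : (lcm_minors v %| m)%N) (m_ge : (n.+1 * lcm_minors v <= m)%N)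
    (S : set (torus R n)) (S_stratum : strata v S) :
  lattice_points R n m `&` S !=set0.
Proof.
case: S_stratum => -[I [X [[XI XnI] ->]]] _.
pose x : 'rV[R]_n := repr (X : torus_quot R n).
have Xx : X = to_torus x by rewrite /to_torus reprK.
have [q mE] := dvdnP D_dvd_m.
have D_gt0 : (0 < lcm_minors v)%N.
  by rewrite lt0n; apply: contraTneq m_gt0 => D0; rewrite mE D0 muln0.
have nq : (n < q)%N by move: m_ge; rewrite mE leq_pmul2r.
have dotP i t : torus_dot (v i) (to_torus t) = 0 <->
    dot (real_vec R (v i)) t \is a Num.int.
  by rewrite torus_dotE; apply: to_circle_eq0.
have xI i : i \in I -> dot (real_vec R (v i)) x \is a Num.int.
  by move=> /XI; rewrite Xx => /dotP.
have xnI i : i \notin I -> dot (real_vec R (v i)) x \isn't a Num.int.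
  by move=> iI; apply/negP => /dotP; rewrite -Xx => Xi; apply: XnI; exists i.
have [y [yZ yI ynI]] := lattice_point_in_cell x v_basis nq.
rewrite -mE in yZ.
exists (to_torus y); split.
  (* The floor only converts the type: the entries of [m y] are already integers. *)
  exists (map_mx Num.floor (m%:R *: y)) => //; congr to_torus.
  apply: (scalerI (a := m%:R)); first by rewrite pnatr_eq0 -lt0n.
  rewrite scalerA mulfV ?scale1r ?pnatr_eq0 -?lt0n //.
  apply/matrixP => i j; rewrite !mxE; apply/eqP; rewrite -intrEfloor.
  by have := mxOverP yZ i j; rewrite !mxE.
rewrite Xx; apply: segment_in_component => t /andP[t0 t1]; split.
  move=> i iI; apply/dotP.
  by rewrite dotDr dotZr dotBr yI ?xI // subrr mulr0 addr0 xI.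
(* Off [I] the values at [x] and [y] lie in one open interval between consecutive integers, so no
   point of the segment has an integral value [a]. *)
case=> i iI /dotP/intrP[a]; have xi := xnI _ iI.
rewrite dotDr dotZr dotBr => aE.
have /andP[x_ge x_lt] := floor_itv (dot (real_vec R (v i)) x).
have /andP[y_gt y_lt] := ynI _ xi.
have x_gt : (Num.floor (dot (real_vec R (v i)) x))%:~R < dot (real_vec R (v i)) x.
  by rewrite lt_neqAle x_ge andbT -intrEfloor.
move: x_gt x_lt y_gt y_lt aE; set f := Num.floor _.
set dx := dot _ x; set dy := dot _ y => x_gt x_lt y_gt y_lt aE.
have : f%:~R < a%:~R :> R by rewrite -aE lt_segment ?t0.
have : a%:~R < (f + 1)%:~R :> R.
  (* Negation reduces the upper bound to the lower bound of [lt_segment]. *)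
  rewrite -ltrN2 -aE (_ : - (dx + _) = - dx + t * (- dy - - dx)); last by ring.
  by rewrite lt_segment ?t0 ?ltrN2.
by rewrite !ltr_int; lia.
Qed.
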